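(* Let $\Theta\subseteq\mathcal B_R^d(0)$ with $0\in\Theta$, suppose Assumptions 1 and 2 hold with constants $L,B>0$, and let $g:\Theta\times\mathcal Z\to\Theta$ be such that $g(\cdot\,;z)$ is $\gamma$-contractive on $\Theta$ for every $z\in\mathcal Z$, for some $\gamma\in(0,1)$. Let $T:=\max\left\{\left\lceil\frac{\log(2LRn)}{\log(1/\gamma)}\right\rceil,0\right\}$. Then for any fixed $\theta^{(0)}\in\Theta$, $t\ge0$ and $i_1,\dots,i_t\in[n]$, the iterate $\theta^{(t)}:=g_{i_t}\circ\cdots\circ g_{i_1}(\theta^{(0)})$ satisfies $$\left|\mathbb E_{z_1,\dots,z_n}\big[\hat F(\theta^{(t)})-F(\theta^{(t)})\big]\right|\le\frac{BT+1}{n}.$$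
   Context: $z_1,\dots,z_n$ i.i.d. from a distribution $\mu$ on $\mathcal Z$, $Z\sim\mu$; $f:\Theta\times\mathcal Z\to\mathbb R$, $F(\theta):=\mathbb E_Z[f(\theta;Z)]$, $\hat F(\theta):=\frac1n\sum_{i=1}^nf(\theta;z_i)$; $g_i:=g(\cdot\,;z_i)$. $\gamma$-contractive: $\|g(\theta;z)-g(\theta';z)\|\le\gamma\|\theta-\theta'\|$. Assumption 1 (constant $L$): there is $h_0:\Theta\to\mathbb R$ with $|f(\theta;z)-h_0(\theta)-(f(\theta';z)-h_0(\theta'))|\le L\|\theta-\theta'\|$ for all $\theta,\theta'\in\Theta$, $z$. Assumption 2 (constant $B$): $\sup_zf(\theta;z)-\inf_zf(\theta;z)\le B$ for all $\theta\in\Theta$. *)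

(* Defs.v *)
From HB Require Import structures.
From mathcomp Require Import all_boot all_order all_algebra.
From mathcomp Require Import all_classical all_reals all_analysis.
Set Implicit Arguments. Unset Strict Implicit. Unset Printing Implicit Defensive.
Import Order.TTheory GRing.Theory Num.Theory.
Import numFieldNormedType.Exports.
Local Open Scope classical_set_scope.
Local Open Scope ring_scope.

Definition enorm {R : realType} {dim : nat} (v : 'rV[R]_dim) : R :=
  Num.sqrt (\sum_(k < dim) v ord0 k ^+ 2).

(* Expectation over an i.i.d. sample (z_1,...,z_n) ~ mu^n of a real function
   of the sample: the iterated integral  E[Phi] = ∫ mu(dz_1) ... ∫ mu(dz_n)
   Phi(z_1,...,z_n)  (i.e. the integral against the product measure mu^n). *)
Fixpoint iid_expect {d} {Z : measurableType d} {R : realType}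
  (mu : {measure set Z -> \bar R}) (n : nat) : (n.-tuple Z -> R) -> \bar R :=
  match n return (n.-tuple Z -> R) -> \bar R with
  | 0 => fun Phi => (Phi [tuple])%:E
  | n'.+1 => fun Phi =>
      (\int[mu]_z iid_expect mu (fun s : n'.-tuple Z => Phi (cons_tuple z s)))%E
  end.

Definition pop_risk {d} {Z : measurableType d} {R : realType}
  (mu : {measure set Z -> \bar R}) {dim : nat} (f : 'rV[R]_dim -> Z -> R)
  (theta : 'rV[R]_dim) : R :=
  fine (\int[mu]_z (f theta z)%:E)%E.

Definition emp_risk {d} {Z : measurableType d} {R : realType} {dim n : nat}
  (f : 'rV[R]_dim -> Z -> R) (zs : n.-tuple Z) (theta : 'rV[R]_dim) : R :=
  (n%:R)^-1 * \sum_(i < n) f theta (tnth zs i).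

Definition iterate {d} {Z : measurableType d} {R : realType} {dim n : nat}
  (g : 'rV[R]_dim -> Z -> 'rV[R]_dim) (zs : n.-tuple Z)
  (theta0 : 'rV[R]_dim) (idx : seq 'I_n) : 'rV[R]_dim :=
  foldl (fun th i => g th (tnth zs i)) theta0 idx.

(* Main.v *)
(* Replace f(theta; z) by H(theta; z) = f(theta; z) - F(theta), which is centered
   in z, bounded by B, and 2L-Lipschitz in theta, since h_0 cancels. Let S be the
   set of the last T indices used. If i is not in S, restarting the last T steps
   from 0 gives a point theta' that does not depend on z_i, so E[H(theta'; z_i)] = 0,
   while contractivity yields |theta^(t) - theta'| <= gamma^T R; hence
   |E[H(theta^(t); z_i)]| <= 2 L R gamma^T <= 1/n. The at most T indices in S
   contribute at most B each. *)

Require Import Defs.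
From HB Require Import structures.
From mathcomp Require Import all_boot all_order all_algebra.
From mathcomp Require Import all_classical all_reals all_analysis.
From mathcomp Require Import measurable_realfun ring lra.
Import Order.TTheory GRing.Theory Num.Theory.
Import numFieldNormedType.Exports.
Local Open Scope classical_set_scope.
Local Open Scope ring_scope.

(** * Iterated integrals of bounded measurable functions *)

Lemma probability_exists {d} {Z : measurableType d} {R : realType}
  (mu : probability Z R) : exists z : Z, True.
Proof.
apply: contrapT => noZ; have : mu set0 = 1%E.
  by rewrite -(probability_setT mu); congr (mu _); apply/seteqP; split => // z _;
     apply: noZ; exists z.
by rewrite measure0 => /eqP; rewrite eq_sym onee_eq0.
Qed.

Lemma bounded_integrable {d} {Z : measurableType d} {R : realType}
  (mu : probability Z R) {u : Z -> R} {C : R} :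
  measurable_fun [set: Z] u -> (forall z, `|u z| <= C) ->
  mu.-integrable [set: Z] (EFin \o u).
Proof.
move=> meas_u bu; apply: measurable_bounded_integrable => //.
  by rewrite -ge0_fin_numE// fin_num_measure.
exists C; split; first exact: num_real.
by move=> M CM z _ /=; apply: le_trans (bu z) (ltW CM).
Qed.

Lemma Rintegral_probability_cst {d} {Z : measurableType d} {R : realType}
  (mu : probability Z R) (c : R) : \int[mu]_z c = c.
Proof. by rewrite Rintegral_cst//= probability_setT mulr1. Qed.

Lemma le_Rintegral_cst {d} {Z : measurableType d} {R : realType}
  (mu : probability Z R) {u : Z -> R} {c C : R} :
  measurable_fun [set: Z] u -> (forall z, `|u z| <= C) ->
  (forall z, u z <= c) -> \int[mu]_z u z <= c.
Proof.
move=> meas_u bu uc; rewrite -[leRHS](Rintegral_probability_cst mu).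
apply: le_Rintegral => //; first exact: bounded_integrable meas_u bu.
exact: finite_measure_integrable_cst.
Qed.

Lemma ge_Rintegral_cst {d} {Z : measurableType d} {R : realType}
  (mu : probability Z R) {u : Z -> R} {c C : R} :
  measurable_fun [set: Z] u -> (forall z, `|u z| <= C) ->
  (forall z, c <= u z) -> c <= \int[mu]_z u z.
Proof.
move=> meas_u bu uc; rewrite -[leLHS](Rintegral_probability_cst mu).
apply: le_Rintegral => //; last exact: bounded_integrable meas_u bu.
exact: finite_measure_integrable_cst.
Qed.

Lemma normr_Rintegral_le {d} {Z : measurableType d} {R : realType}
  (mu : probability Z R) {u : Z -> R} {C : R} :
  measurable_fun [set: Z] u -> (forall z, `|u z| <= C) ->
  `|\int[mu]_z u z| <= C.
Proof.
move=> meas_u bu; rewrite ler_norml; apply/andP; split.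
  by apply: (ge_Rintegral_cst mu meas_u bu) => z; have := bu z; rewrite ler_norml => /andP[].
by apply: (le_Rintegral_cst mu meas_u bu) => z; have := bu z; rewrite ler_norml => /andP[].
Qed.

(** Tonelli gives measurability of a partial integral for nonnegative integrands; the signed case
    follows by subtracting the partial integrals of the positive and negative parts. *)
Lemma measurable_integral_section {dX d} {X : measurableType dX}
  {Z : measurableType d} {R : realType} (mu : probability Z R)
  {v : X * Z -> \bar R} : measurable_fun [set: X * Z] v ->
  measurable_fun [set: X] (fun x => \int[mu]_z v (x, z))%E.
Proof.
move=> mv.
have -> : (fun x => \int[mu]_z v (x, z))%E =
    ((fun x => \int[mu]_z v^\+ (x, z)) \- (fun x => \int[mu]_z v^\- (x, z)))%E.
  apply/funext => x; rewrite [LHS]integralE.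
  under eq_integral do rewrite funepos_comp/=.
  by under [X in (_ - X)%E = _]eq_integral do rewrite funeneg_comp/=.
apply: emeasurable_funB.
  by apply: (measurable_fun_fubini_tonelli_F (v^\+)%E) => //;
    exact: measurable_funepos.
by apply: (measurable_fun_fubini_tonelli_F (v^\-)%E) => //;
  exact: measurable_funeneg.
Qed.

Lemma measurable_Rintegral_section {dX d} {X : measurableType dX}
  {Z : measurableType d} {R : realType} (mu : probability Z R)
  {u : X * Z -> R} : measurable_fun [set: X * Z] u ->
  measurable_fun [set: X] (fun x => \int[mu]_z u (x, z)).
Proof.
move=> meas_u; apply: measurableT_comp => //.
by apply: (measurable_integral_section mu (v := EFin \o u)); exact/measurable_EFinP.
Qed.

Lemma Rintegral_EFinE {d} {Z : measurableType d} {R : realType}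
  (mu : probability Z R) {u : Z -> R} {C : R} :
  measurable_fun [set: Z] u -> (forall z, `|u z| <= C) ->
  (\int[mu]_z (u z)%:E)%E = (\int[mu]_z u z)%:E.
Proof.
move=> meas_u bu; rewrite fineK//.
exact: integrable_fin_num (bounded_integrable mu meas_u bu).
Qed.

Lemma Rintegral_exchange {d1 d2} {X : measurableType d1} {Y : measurableType d2}
  {R : realType} (P : probability X R) (Q : probability Y R) {u : X * Y -> R}
  {C : R} : measurable_fun [set: X * Y] u -> (forall p, `|u p| <= C) ->
  \int[P]_x \int[Q]_y u (x, y) = \int[Q]_y \int[P]_x u (x, y).
Proof.
move=> meas_u bu.
(* Only the outer integrals are unfolded; boundedness absorbs the inner [fine], so that Fubini for
   extended reals applies. Its integrability condition holds because both measures have mass 1,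
   which bounds the double integral of [|u|] by [C]. *)
rewrite {1}/Rintegral {2}/Rintegral.
under eq_integral do rewrite -(Rintegral_EFinE Q
  (measurableT_comp meas_u (pair1_measurable _)) (fun=> bu _)).
under [in RHS]eq_integral do rewrite -(Rintegral_EFinE P
  (measurableT_comp meas_u (pair2_measurable _)) (fun=> bu _)).
congr fine; apply: (Fubini (f := EFin \o u)).
apply/integrable12ltyP; first exact/measurable_EFinP.
apply: (@le_lt_trans _ _ (\int[P]_x C%:E)%E); last first.
  by rewrite integral_cst//= probability_setT mule1 ltry.
have mnu : measurable_fun [set: X * Y] (fun p => `|u p|%:E).
  by apply/measurable_EFinP; exact: measurableT_comp.
apply: ge0_le_integral => //.
- by move=> x _; exact: integral_ge0.
- exact: (measurable_fun_fubini_tonelli_F (fun p => `|u p|%:E)).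
- move=> x _; have -> : C%:E = (\int[Q]_y C%:E)%E.
    by rewrite integral_cst//= probability_setT mule1.
  apply: ge0_le_integral => //.
  + exact: (measurableT_comp mnu (pair1_measurable x)).
  + by move=> y _; rewrite lee_fin.
Qed.

(** * Expectation over an i.i.d. sample *)

(** Real-valued twin of [iid_expect], which lets sums and differences be handled in [R];
    [iid_expectE] identifies the two on bounded measurable functions. *)
Fixpoint iid_mean {d} {Z : measurableType d} {R : realType}
  (mu : probability Z R) (n : nat) : (n.-tuple Z -> R) -> R :=
  match n return (n.-tuple Z -> R) -> R with
  | 0 => fun Phi => Phi [tuple]
  | n'.+1 => fun Phi => \int[mu]_z iid_mean mu n' (fun s => Phi (cons_tuple z s))
  end.

Lemma measurable_cons_tuple {dX d} {X : measurableType dX} {Z : measurableType d}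
  {n : nat} {u : X -> Z} {v : X -> n.-tuple Z} :
  measurable_fun [set: X] u -> measurable_fun [set: X] v ->
  measurable_fun [set: X] (fun x => cons_tuple (u x) (v x)).
Proof. exact: measurable_cons. Qed.

Section iid_mean_theory.
Context {d : measure_display} {Z : measurableType d} {R : realType}.
Variable mu : probability Z R.

(** The parameter space varies in the induction: the step moves the first sample coordinate into the
    parameter and uses the induction hypothesis at [X * Z]. *)
Lemma measurable_iid_mean_section {dX} {X : measurableType dX} (n : nat)
  (Phi : X * n.-tuple Z -> R) : measurable_fun setT Phi ->
  measurable_fun [set: X] (fun x => iid_mean mu n (fun s => Phi (x, s))).
Proof.
elim: n dX X Phi => [|n IHn] dX X Phi mPhi /=.
  exact: (measurableT_comp mPhi (pair2_measurable _)).
apply: (measurable_Rintegral_section mu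
  (u := fun p => iid_mean mu n (fun s => Phi (p.1, cons_tuple p.2 s)))).
apply: (IHn _ (X * Z)%type (fun q => Phi (q.1.1, cons_tuple q.1.2 q.2))).
apply: (measurableT_comp mPhi); apply: measurable_fun_pair.
  exact: measurableT_comp.
by apply: measurable_cons_tuple => //; exact: measurableT_comp.
Qed.

Lemma measurable_cons_section {n : nat} {Phi : n.+1.-tuple Z -> R} (z : Z) :
  measurable_fun setT Phi ->
  measurable_fun setT (fun s : n.-tuple Z => Phi (cons_tuple z s)).
Proof. by move=> mPhi; apply: (measurableT_comp mPhi); exact: measurable_cons_tuple. Qed.

Lemma measurable_iid_mean_cons {n : nat} {Phi : n.+1.-tuple Z -> R} :
  measurable_fun setT Phi ->
  measurable_fun setT (fun z => iid_mean mu n (fun s => Phi (cons_tuple z s))).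
Proof.
move=> mPhi.
apply: (measurable_iid_mean_section n (fun p => Phi (cons_tuple p.1 p.2))).
by apply: (measurableT_comp mPhi); exact: measurable_cons_tuple.
Qed.

Lemma normr_iid_mean_le {n : nat} {Phi : n.-tuple Z -> R} {C : R} :
  measurable_fun setT Phi -> (forall s, `|Phi s| <= C) ->
  `|iid_mean mu n Phi| <= C.
Proof.
elim: n Phi => [|n IHn] Phi mPhi bPhi //=.
apply: normr_Rintegral_le; first exact: measurable_iid_mean_cons.
by move=> z; apply: IHn => //; exact: measurable_cons_section.
Qed.

Lemma iid_expectE {n : nat} {Phi : n.-tuple Z -> R} {C : R} :
  measurable_fun setT Phi -> (forall s, `|Phi s| <= C) ->
  iid_expect mu Phi = (iid_mean mu n Phi)%:E.
Proof.
elim: n Phi => [|n IHn] Phi mPhi bPhi //=.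
under eq_integral => z _ do
  rewrite (IHn _ (measurable_cons_section z mPhi) (fun s => bPhi _)).
apply: (Rintegral_EFinE mu (C := C)); first exact: measurable_iid_mean_cons.
by move=> z; apply: normr_iid_mean_le => //; exact: measurable_cons_section.
Qed.

Lemma iid_meanD {n : nat} {Phi Psi : n.-tuple Z -> R} {C D : R} :
  measurable_fun setT Phi -> (forall s, `|Phi s| <= C) ->
  measurable_fun setT Psi -> (forall s, `|Psi s| <= D) ->
  iid_mean mu n (fun s => Phi s + Psi s) = iid_mean mu n Phi + iid_mean mu n Psi.
Proof.
elim: n Phi Psi => [|n IHn] Phi Psi mPhi bPhi mPsi bPsi //=.
under eq_Rintegral => z _ do rewrite (IHn _ _ (measurable_cons_section z mPhi)
  (fun s => bPhi _) (measurable_cons_section z mPsi) (fun s => bPsi _)).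
apply: RintegralD => //.
- apply: (bounded_integrable mu (C := C)); first exact: measurable_iid_mean_cons.
  by move=> z; apply: normr_iid_mean_le => //; exact: measurable_cons_section.
- apply: (bounded_integrable mu (C := D)); first exact: measurable_iid_mean_cons.
  by move=> z; apply: normr_iid_mean_le => //; exact: measurable_cons_section.
Qed.

Lemma iid_mean0 (n : nat) : iid_mean mu n (fun=> 0) = 0.
Proof.
by elim: n => [//|n IHn] /=; rewrite IHn Rintegral_probability_cst.
Qed.

Lemma iid_mean_sum {n : nat} {I : Type} (r : seq I) {Phi : I -> n.-tuple Z -> R}
  {C : R} :
  (forall i, measurable_fun setT (Phi i)) -> (forall i s, `|Phi i s| <= C) ->
  iid_mean mu n (fun s => \sum_(i <- r) Phi i s) =
  \sum_(i <- r) iid_mean mu n (Phi i).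
Proof.
move=> mPhi bPhi; elim: r => [|i r IHr].
  by rewrite big_nil -[RHS](iid_mean0 n); congr iid_mean; apply/funext => s;
     rewrite big_nil.
rewrite big_cons -IHr -(@iid_meanD _ _ _ C (\sum_(j <- r) C))//.
- by congr iid_mean; apply/funext => s; rewrite big_cons.
- exact: measurable_sum.
- by move=> s; apply: le_trans (ler_norm_sum _ _ _) (ler_sum _ _) => j _.
Qed.

Lemma iid_meanZl {n : nat} (c : R) {Phi : n.-tuple Z -> R} {C : R} :
  measurable_fun setT Phi -> (forall s, `|Phi s| <= C) ->
  iid_mean mu n (fun s => c * Phi s) = c * iid_mean mu n Phi.
Proof.
elim: n Phi => [|n IHn] Phi mPhi bPhi //=.
under eq_Rintegral => z _ do
  rewrite (IHn _ (measurable_cons_section z mPhi) (fun s => bPhi _)).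
apply: RintegralZl => //.
apply: (bounded_integrable mu (C := C)); first exact: measurable_iid_mean_cons.
by move=> z; apply: normr_iid_mean_le => //; exact: measurable_cons_section.
Qed.

(** Fubini with one extra variable, which is carried past the sample coordinates one at a time. *)
Lemma Rintegral_iid_mean {n : nat} {Phi : Z * n.-tuple Z -> R} {C : R} :
  measurable_fun setT Phi -> (forall p, `|Phi p| <= C) ->
  \int[mu]_z iid_mean mu n (fun s => Phi (z, s)) =
  iid_mean mu n (fun s => \int[mu]_z Phi (z, s)).
Proof.
elim: n Phi => [|n IHn] Phi mPhi bPhi //=.
have mcons : measurable_fun setT
    (fun q : Z * Z * n.-tuple Z => Phi (q.1.1, cons_tuple q.1.2 q.2)).
  apply: (measurableT_comp mPhi); apply: measurable_fun_pair.
    exact: measurableT_comp.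
  by apply: measurable_cons_tuple => //; exact: measurableT_comp.
rewrite (Rintegral_exchange mu mu (C := C)
  (u := fun p => iid_mean mu n (fun s => Phi (p.1, cons_tuple p.2 s)))).
- apply: eq_Rintegral => w _.
  apply: (IHn (fun p => Phi (p.1, cons_tuple w p.2))) => //.
  apply: (measurableT_comp mPhi); apply: measurable_fun_pair => //.
  exact: measurable_cons_tuple.
- exact: (measurable_iid_mean_section n
    (fun q : Z * Z * n.-tuple Z => Phi (q.1.1, cons_tuple q.1.2 q.2))).
- move=> p; apply: normr_iid_mean_le => //.
  exact: (measurableT_comp mcons (pair1_measurable p)).
Qed.

Definition tuple_upd {n : nat} (s : n.-tuple Z) (i : 'I_n) (z : Z) : n.-tuple Z :=
  [tuple if j == i then z else tnth s j | j < n].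

Lemma tuple_upd_cons0 {n : nat} (s : n.-tuple Z) (w z : Z) :
  tuple_upd (cons_tuple w s) ord0 z = cons_tuple z s.
Proof.
apply: eq_from_tnth => k; rewrite tnth_mktuple.
by case: (unliftP ord0 k) => [j ->|->]; rewrite ?tnthS ?tnth0.
Qed.

Lemma tuple_upd_consS {n : nat} (s : n.-tuple Z) (i : 'I_n) (w z : Z) :
  tuple_upd (cons_tuple w s) (lift ord0 i) z = cons_tuple w (tuple_upd s i z).
Proof.
apply: eq_from_tnth => k; rewrite tnth_mktuple.
case: (unliftP ord0 k) => [j ->|->]; rewrite ?tnthS ?tnth0//.
by rewrite tnth_mktuple (inj_eq lift_inj).
Qed.

(** Coordinate [i] may be integrated first. If it is the head, [Rintegral_iid_mean] moves the outer
    integral innermost; otherwise the induction hypothesis applies under the outer integral. *)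
Lemma iid_mean_eq0 {n : nat} (i : 'I_n) {Phi : n.-tuple Z -> R} {C : R} :
  measurable_fun setT Phi -> (forall s, `|Phi s| <= C) ->
  (forall s, \int[mu]_z Phi (tuple_upd s i z) = 0) -> iid_mean mu n Phi = 0.
Proof.
have [z0 _] := probability_exists mu.
elim: n i Phi => [[]//|n IHn] i Phi mPhi bPhi Phi0 /=.
case: (unliftP ord0 i) => [j|] ij; subst i.
- rewrite -[RHS](Rintegral_probability_cst mu); apply: eq_Rintegral => z _.
  apply: (IHn j) => //; first exact: measurable_cons_section.
  move=> s; rewrite -[RHS](Phi0 (cons_tuple z s)).
  by apply: eq_Rintegral => w _; rewrite tuple_upd_consS.
- rewrite (Rintegral_iid_mean (C := C)
    (Phi := fun p => Phi (cons_tuple p.1 p.2)))//; last first.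
    by apply: (measurableT_comp mPhi); exact: measurable_cons_tuple.
  rewrite -[RHS](iid_mean0 n); congr iid_mean; apply/funext => s.
  (* The head [z0] is an arbitrary filler, overwritten by the update. *)
  rewrite -[RHS](Phi0 (cons_tuple z0 s)).
  by apply: eq_Rintegral => w _; rewrite tuple_upd_cons0.
Qed.

End iid_mean_theory.

(** * Measurability of Lipschitz functions of a measurable point *)

(** The l1 norm dominates [enorm] and is a plain sum over coordinates, which makes its triangle
    inequality and its measurability immediate. *)
Definition norm1 {R : realType} {dim : nat} (v : 'rV[R]_dim) : R :=
  \sum_(k < dim) `|v ord0 k|.

Lemma norm1_ge0 {R : realType} {dim : nat} (v : 'rV[R]_dim) : 0 <= norm1 v.
Proof. exact: sumr_ge0. Qed.

Lemma norm1_distC {R : realType} {dim : nat} (u v : 'rV[R]_dim) :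
  norm1 (u - v) = norm1 (v - u).
Proof. by apply: eq_bigr => k _; rewrite !mxE distrC. Qed.

Lemma norm1_triangle {R : realType} {dim : nat} (u v w : 'rV[R]_dim) :
  norm1 (u - w) <= norm1 (u - v) + norm1 (v - w).
Proof.
rewrite /norm1 -big_split; apply: ler_sum => k _ /=; rewrite !mxE.
by rewrite (le_trans _ (ler_normD _ _))// addrA subrK.
Qed.

Lemma enorm_le_norm1 {R : realType} {dim : nat} (v : 'rV[R]_dim) :
  enorm v <= norm1 v.
Proof.
rewrite -[leRHS]ger0_norm ?norm1_ge0// -sqrtr_sqr ler_wsqrtr//.
rewrite expr2 /norm1 mulr_suml; apply: ler_sum => k _.
rewrite -real_normK ?num_real// expr2 ler_wpM2l// (bigD1 k)//= lerDl.
exact: sumr_ge0.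
Qed.

Lemma normr_entry_le_enorm {R : realType} {dim : nat} (v : 'rV[R]_dim) k :
  `|v ord0 k| <= enorm v.
Proof.
rewrite -sqrtr_sqr ler_wsqrtr// (bigD1 k)//= lerDl.
by apply: sumr_ge0 => j _; exact: sqr_ge0.
Qed.

Lemma enorm0 {R : realType} {dim : nat} : enorm (0 : 'rV[R]_dim) = 0.
Proof.
rewrite /enorm big1 ?sqrtr0// => k _; by rewrite mxE expr0n.
Qed.

Lemma rat_vector_dense {R : realType} {dim : nat} (v : 'rV[R]_dim) (e : R) :
  0 < e -> exists q : 'rV[rat]_dim, norm1 (v - map_mx ratr q) < e.
Proof.
(* Dividing by [dim + 1] keeps the total error strictly below [e] although each coordinate error is
   only [<= e'], and it covers dimension 0. *)
move=> e0; pose e' := e / (dim%:R + 1).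
have d0 : 0 < dim%:R + 1 :> R by rewrite ltr_wpDl.
have e'0 : 0 < e' by rewrite divr_gt0.
have /fin_all_exists[q qP] : forall k : 'I_dim, exists q : rat, `|v ord0 k - ratr q| <= e'.
  move=> k; have [|q] := @rat_in_itvoo R (v ord0 k - e') (v ord0 k).
    by rewrite ltrBlDr ltrDl.
  rewrite in_itv/= => /andP[h1 h2]; exists q.
  by rewrite ger0_norm ?subr_ge0; [rewrite lerBlDr -lerBlDl|]; exact: ltW.
exists (\row_k q k); apply: (@le_lt_trans _ _ (\sum_(k < dim) e')).
  by apply: ler_sum => k _; rewrite !mxE.
rewrite sumr_const card_ord -mulr_natr /e' -mulrA gtr_pMr//.
by rewrite ltr_pdivrMl// mulr1 ltrDl.
Qed.

(** Rational points need not lie in [A]. For each rational centre and radius [1/(m+1)], a point of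
    [A] in that ball is chosen if there is one, and [a0] otherwise. *)
Lemma countable_dense_subset {R : realType} {dim : nat} (A : set 'rV[R]_dim) :
  A !=set0 -> exists q : nat -> 'rV[R]_dim, (forall k, A (q k)) /\
    forall v e, A v -> 0 < e -> exists k, norm1 (v - q k) < e.
Proof.
move=> [a0 Aa0].
pose near_pt (c : 'rV[rat]_dim * nat) := fun a : 'rV[R]_dim =>
  A a /\ norm1 (a - map_mx ratr c.1) < c.2.+1%:R^-1.
have /choice[p pP] : forall c, exists a, A a /\ ((exists b, near_pt c b) -> near_pt c a).
  move=> c; have [[b nb]|nb] := pselect (exists b, near_pt c b).
    by exists b; split => //; case: nb.
  by exists a0.
exists (fun k => if unpickle k is Some c then p c else a0); split.
  by move=> k; case: unpickle => // c; case: (pP c).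
move=> v e Av e0.
(* Half of [e], since the radius is spent twice: from [v] to the rational centre, and from there to
   the chosen point. *)
have [m me] : exists m : nat, m.+1%:R^-1 < e / 2.
  exists (Num.truncn (e / 2)^-1).
  by rewrite invf_plt ?posrE ?divr_gt0// truncnS_gt.
have m0 : 0 < m.+1%:R^-1 :> R by rewrite invr_gt0.
have [q vq] := rat_vector_dense v _ m0.
exists (pickle (q, m)); rewrite pickleK.
have [_ [|_ /= pq]] := pP (q, m); first by exists v.
apply: le_lt_trans (norm1_triangle _ (map_mx ratr q) _) _.
rewrite [X in _ + X]norm1_distC (splitr e).
by apply: ltrD; exact: lt_trans me.
Qed.

(* McShane's formula expresses the composite as an infimum over a countable
   dense subset of A of functions that are visibly measurable. *)
Lemma measurable_caratheodory {dX d} {X : measurableType dX}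
  {Z : measurableType d} {R : realType} {dim : nat} {A : set 'rV[R]_dim}
  {h : 'rV[R]_dim -> Z -> R} {K : R} {phi : X -> 'rV[R]_dim} {zeta : X -> Z} :
  0 < K ->
  (forall a, A a -> measurable_fun setT (h a)) ->
  (forall a b z, A a -> A b -> `|h a z - h b z| <= K * enorm (a - b)) ->
  (forall x, A (phi x)) ->
  (forall k, measurable_fun setT (fun x => phi x ord0 k)) ->
  measurable_fun setT zeta ->
  measurable_fun setT (fun x => h (phi x) (zeta x)).
Proof.
move=> K0 mh lh Aphi mphi mzeta.
(* A point of [X] is what shows that [A] is nonempty; over an empty [X] measurability is trivial. *)
have [[x0 _]|X0] := pselect (exists x : X, True); last first.
  by move=> _ Y _; rewrite (_ : _ `&` _ = set0)//; apply/seteqP; split => // x;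
     case: X0; exists x.
have [|q [Aq dq]] := countable_dense_subset A; first by exists (phi x0).
pose u k x := h (q k) (zeta x) + K * norm1 (phi x - q k).
have hle k x : h (phi x) (zeta x) <= u k x.
  have := lh _ _ (zeta x) (Aphi x) (Aq k).
  have := enorm_le_norm1 (phi x - q k); rewrite -(ler_pM2l K0).
  by move=> h1 h2; have := le_trans (le_trans (ler_norm _) h2) h1; rewrite lerBlDl.
have lbu x : has_lbound (range (u ^~ x)).
  by exists (h (phi x) (zeta x)) => _ [k _ <-].
rewrite (_ : (fun x => _) = fun x => infs (u ^~ x) 0%N).
  apply: measurable_fun_infs => // k; apply: measurable_funD.
    by apply: measurableT_comp => //; exact: mh.
  apply: measurable_funM => //; apply: measurable_sum => j.
  apply: measurableT_comp => //.
  rewrite (_ : (fun x => _) = fun x => phi x ord0 j - q k ord0 j); last first.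
    by apply/funext => x; rewrite !mxE.
  exact: measurable_funB.
apply/funext => x; rewrite /infs /=.
have -> : sdrop (u ^~ x) 0 = range (u ^~ x).
  by apply/seteqP; split => _ [k _ <-]; exists k.
apply/eqP; rewrite eq_le; apply/andP; split.
  by apply: lb_le_inf => [|_ [k _ <-]//]; exists (u 0%N x), 0%N.
apply/ler_addgt0Pr => e e0.
(* At this distance the penalty term of [u k x] and the Lipschitz variation of [h] each cost at most
   [e / 2]. *)
have [|k ke] := dq (phi x) (e / (K * 2)) (Aphi x).
  by rewrite divr_gt0// mulr_gt0.
apply: (@le_trans _ _ (u k x)); first by apply: ge_inf => //; exists k.
have h2 := lh _ _ (zeta x) (Aq k) (Aphi x).
have h1 := enorm_le_norm1 (q k - phi x); rewrite -(ler_pM2l K0) norm1_distC in h1.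
have h3 : K * norm1 (phi x - q k) <= e / 2.
  rewrite mulrC -ler_pdivlMr// (le_trans (ltW ke))//.
  by rewrite invfM mulrA mulrAC.
have h4 := le_trans (le_trans (ler_norm _) h2) h1.
rewrite /u; move: h3 h4; set a := K * _; set b := h (q k) _; set c := h (phi x) _.
lra.
Qed.

(** * Centered losses and contractive iterates *)

Section centering.
Context {d : measure_display} {Z : measurableType d} {R : realType}.
Variable mu : probability Z R.

Lemma osc_bounded {u : Z -> R} {B : R} :
  (forall z w, u z - u w <= B) -> exists C, forall z, `|u z| <= C.
Proof.
move=> osc; have [z0 _] := probability_exists mu.
exists (`|u z0| + B) => z; rewrite -[u z](subrK (u z0)) addrC.
rewrite (le_trans (ler_normD _ _))// lerD2l ler_norml osc andbT.
by rewrite lerNl opprB osc.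
Qed.

Lemma normr_centered_le {u : Z -> R} {B : R} (z : Z) :
  measurable_fun setT u -> (forall z w, u z - u w <= B) ->
  `|u z - \int[mu]_w u w| <= B.
Proof.
move=> meas_u osc; have [C bu] := osc_bounded osc.
rewrite ler_norml; apply/andP; split.
  rewrite lerBrDr addrC -lerBrDr opprK; apply: (le_Rintegral_cst mu meas_u bu) => w.
  by rewrite -lerBlDl osc.
rewrite lerBlDr -lerBlDl; apply: (ge_Rintegral_cst mu meas_u bu) => w.
by rewrite lerBlDr -lerBlDl osc.
Qed.

Lemma Rintegral_centered {u : Z -> R} {B : R} :
  measurable_fun setT u -> (forall z w, u z - u w <= B) ->
  \int[mu]_z (u z - \int[mu]_w u w) = 0.
Proof.
move=> meas_u osc; have [C bu] := osc_bounded osc.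
rewrite RintegralB// ?Rintegral_probability_cst ?subrr//.
  exact: (bounded_integrable mu meas_u bu).
exact: finite_measure_integrable_cst.
Qed.

(** The values of [u - v] all lie in the interval of radius [D] around [a - b], hence so does their
    mean; two points of it are at most [2 * D] apart. The offsets [a], [b] stand for values of
    [h0]. *)
Lemma normr_centeredB_le {u v : Z -> R} {B a b D : R} (z : Z) :
  measurable_fun setT u -> (forall z w, u z - u w <= B) ->
  measurable_fun setT v -> (forall z w, v z - v w <= B) ->
  (forall z, `|u z - a - (v z - b)| <= D) ->
  `|u z - \int[mu]_w u w - (v z - \int[mu]_w v w)| <= 2 * D.
Proof.
move=> meas_u oscu mv oscv uvD.
have [C bu] := osc_bounded oscu; have [C' bv] := osc_bounded oscv.
have muv : measurable_fun setT (fun z => u z - v z) by exact: measurable_funB.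
have buv w : `|u w - v w| <= C + C'.
  by rewrite (le_trans (ler_normB _ _))// lerD.
have uvE : \int[mu]_w (u w - v w) = \int[mu]_w u w - \int[mu]_w v w.
  by apply: RintegralB => //;
    [exact: (bounded_integrable mu meas_u bu)|exact: (bounded_integrable mu mv bv)].
have uv w : a - b - D <= u w - v w <= a - b + D.
  by have := uvD w; rewrite ler_norml => /andP[h1 h2]; apply/andP; split; lra.
have h1 : \int[mu]_w (u w - v w) <= a - b + D.
  by apply: (le_Rintegral_cst mu muv buv) => w; have /andP[] := uv w.
have h2 : a - b - D <= \int[mu]_w (u w - v w).
  by apply: (ge_Rintegral_cst mu muv buv) => w; have /andP[] := uv w.
move: h1 h2 (uv z); rewrite uvE => h1 h2 /andP[h3 h4].
by rewrite ler_norml; apply/andP; split; lra.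
Qed.

End centering.

Section iterate_theory.
Context {d : measure_display} {Z : measurableType d} {R : realType} {dim n : nat}.
Variables (Theta : set 'rV[R]_dim) (g : 'rV[R]_dim -> Z -> 'rV[R]_dim).
Hypothesis gTheta : forall th z, Theta th -> Theta (g th z).

Lemma iterate_mem (zs : n.-tuple Z) th idx : Theta th -> Theta (iterate g zs th idx).
Proof. by rewrite /iterate; elim: idx th => //= i idx IH th ?; exact/IH/gTheta. Qed.

Lemma iterate_contraction {gamma : R} (zs : n.-tuple Z) a b idx :
  0 <= gamma ->
  (forall z th th', Theta th -> Theta th' ->
     enorm (g th z - g th' z) <= gamma * enorm (th - th')) ->
  Theta a -> Theta b ->
  enorm (iterate g zs a idx - iterate g zs b idx) <=
  gamma ^+ size idx * enorm (a - b).
Proof.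
move=> gamma0 contr; rewrite /iterate.
elim: idx a b => [|i idx IH] a b Ta Tb /=; first by rewrite mul1r.
apply: le_trans (IH _ _ (gTheta _ _ Ta) (gTheta _ _ Tb)) _.
by rewrite exprSr -mulrA ler_wpM2l ?exprn_ge0// contr.
Qed.

Lemma iterate_tuple_upd (zs : n.-tuple Z) i z th idx : i \notin idx ->
  iterate g (tuple_upd zs i z) th idx = iterate g zs th idx.
Proof.
rewrite /iterate; elim: idx th => //= j idx IH th.
rewrite inE negb_or => /andP[ij inidx].
by rewrite IH// tnth_mktuple eq_sym (negbTE ij).
Qed.

(** Induction on the last index, the outermost application of [g]: each coordinate of [g] is
    [gamma]-Lipschitz in its first argument, so [measurable_caratheodory] allows the earlier iterate
    to be substituted there. *)
Lemma measurable_iterate {gamma : R} th idx k : 0 < gamma ->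
  (forall th k, Theta th -> measurable_fun setT (fun z => g th z ord0 k)) ->
  (forall z th th', Theta th -> Theta th' ->
     enorm (g th z - g th' z) <= gamma * enorm (th - th')) ->
  Theta th ->
  measurable_fun setT (fun zs : n.-tuple Z => iterate g zs th idx ord0 k).
Proof.
move=> gamma0 mg contr Tth; elim/last_ind: idx k => [|idx i IH] k.
  exact: measurable_cst.
rewrite (_ : (fun zs => _) =
  fun zs => g (iterate g zs th idx) (tnth zs i) ord0 k); last first.
  by apply/funext => zs; rewrite /iterate foldl_rcons.
apply: (measurable_caratheodory (A := Theta) (h := fun th z => g th z ord0 k)
  (K := gamma)) => //.
- by move=> a Ta; exact: mg.
- move=> a b z Ta Tb; apply: le_trans (contr z a b Ta Tb).
  by apply: le_trans (normr_entry_le_enorm _ k); rewrite !mxE.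
- by move=> zs; exact: iterate_mem.
- exact: measurable_tnth.
Qed.

End iterate_theory.

(** * Choice of the truncation length and restart of the iteration *)

(** On taking logarithms, the bound says that [m] is at least [ln x / ln (gamma^-1)]. The maximum
    with 0 makes the ceiling a natural number, usable as an exponent. *)
Lemma ceil_log_contraction {R : realType} (gamma x : R) :
  0 < gamma < 1 -> 0 < x ->
  exists m : nat,
    m%:R = Num.max ((Num.ceil (ln x / ln (gamma^-1)))%:~R) 0 :> R /\
    gamma ^+ m * x <= 1.
Proof.
move=> /andP[gamma0 gamma1] x0; set c := Num.ceil _.
have [m mE] : exists m : nat, m%:R = Num.max (c%:~R) 0 :> R.
  have [c0|c0] := leP 0 c.
    exists `|c|%N; rewrite natr_absz ger0_norm// max_l//.
    by rewrite ler0z.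
  by exists 0%N; rewrite max_r// lerz0 ltW.
exists m; split => //.
have lng : 0 < ln gamma^-1 by rewrite ln_gt0// invf_gt1.
have : ln x / ln gamma^-1 <= m%:R.
  by rewrite (le_trans (ceil_ge _))// mE le_max lexx.
rewrite ler_pdivrMr// lnV ?posrE// => lnx.
have gm0 : 0 < gamma ^+ m by rewrite exprn_gt0.
rewrite -ler_ln ?posrE ?mulr_gt0// ln1 lnM ?posrE// lnXn// -mulr_natl.
by rewrite mulrN in lnx; lra.
Qed.

(* th1 is 0 and S is the list of the last m indices, unless there are at most m
   indices, in which case nothing has to be forgotten and th1 = th0. *)
Lemma iterate_suffix {d} {Z : measurableType d} {R : realType} {dim n : nat}
  {Theta : set 'rV[R]_dim} {g : 'rV[R]_dim -> Z -> 'rV[R]_dim} {Rad gamma : R}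
  (m : nat) (th0 : 'rV[R]_dim) (idx : seq 'I_n) :
  0 < Rad -> (forall th, Theta th -> enorm th <= Rad) -> Theta 0 ->
  (forall th z, Theta th -> Theta (g th z)) -> 0 < gamma ->
  (forall z th th', Theta th -> Theta th' ->
     enorm (g th z - g th' z) <= gamma * enorm (th - th')) ->
  Theta th0 ->
  exists (th1 : 'rV[R]_dim) (S : seq 'I_n), [/\ Theta th1, (size S <= m)%N &
    forall zs : n.-tuple Z,
    enorm (iterate g zs th0 idx - iterate g zs th1 S) <= gamma ^+ m * Rad].
Proof.
move=> Rad0 bTheta T0 gTheta gamma0 contr Tth0.
have [idxm|midx] := leqP (size idx) m.
  exists th0, idx; split => // zs.
  by rewrite subrr enorm0 mulr_ge0 ?exprn_ge0// ltW.
pose k := (size idx - m)%N; exists 0, (drop k idx).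
have szm : size (drop k idx) = m by rewrite size_drop subKn// ltnW.
split=> //; first by rewrite szm.
(* The prefix ends at a point of [Theta], within [Rad] of 0; the [m] remaining steps contract that
   distance. *)
move=> zs; rewrite -[in iterate g zs th0 _](cat_take_drop k idx).
rewrite {1}/iterate foldl_cat -/(iterate g zs th0 _) -/(iterate g zs _ (drop k idx)).
have Tth := iterate_mem Theta g gTheta zs th0 (take k idx) Tth0.
apply: le_trans
  (iterate_contraction Theta g gTheta zs _ _ _ (ltW gamma0) contr Tth T0) _.
by rewrite szm subr0 ler_wpM2l ?exprn_ge0 ?(ltW gamma0)//; exact: bTheta.
Qed.

(** * Bound on the generalization gap *)

Theorem theorem8 (R : realType) (d : measure_display) (Z : measurableType d)
  (mu : probability Z R) (dim n : nat) (Rad L B gamma : R)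
  (Theta : set 'rV[R]_dim)
  (f : 'rV[R]_dim -> Z -> R) (g : 'rV[R]_dim -> Z -> 'rV[R]_dim) :
  (0 < n)%N -> 0 < Rad ->
  (forall th, Theta th -> enorm th <= Rad) ->
  Theta 0 ->
  (* measurability of f(theta; .) and g(theta; .) (implicit in the paper) *)
  (forall th, Theta th -> measurable_fun [set: Z] (f th)) ->
  (forall th (k : 'I_dim), Theta th ->
     measurable_fun [set: Z] (fun z => g th z ord0 k)) ->
  (* Assumption 1 with constant L > 0 *)
  0 < L ->
  (exists h0 : 'rV[R]_dim -> R, forall th th' z, Theta th -> Theta th' ->
     `|f th z - h0 th - (f th' z - h0 th')| <= L * enorm (th - th')) ->
  (* Assumption 2 with constant B > 0 *)
  0 < B ->
  (forall th, Theta th ->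
     (ereal_sup (range (fun z => (f th z)%:E)) -
      ereal_inf (range (fun z => (f th z)%:E)) <= B%:E)%E) ->
  (* g maps Theta x Z into Theta, and g(.; z) is gamma-contractive *)
  (forall th z, Theta th -> Theta (g th z)) ->
  0 < gamma < 1 ->
  (forall z th th', Theta th -> Theta th' ->
     enorm (g th z - g th' z) <= gamma * enorm (th - th')) ->
  let T : R := Num.max
      ((Num.ceil (ln (2 * L * Rad * n%:R) / ln (gamma^-1)))%:~R) 0 in
  forall (theta0 : 'rV[R]_dim) (idx : seq 'I_n), Theta theta0 ->
  (`| iid_expect mu (fun zs : n.-tuple Z =>
        (emp_risk f zs (iterate g zs theta0 idx)
        - pop_risk mu f (iterate g zs theta0 idx))%R) |
     <= ((B * T + 1) / n%:R)%:E)%E.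
Proof.
move=> n0 Rad0 bTheta T0 mf mg L0 [h0 f_lip] B0 f_osc gTheta gamma01 contr T th0 idx Tth0.
have osc th : Theta th -> forall z w, f th z - f th w <= B.
  move=> Tth z w; rewrite -lee_fin EFinB; apply: le_trans (f_osc _ Tth).
  by apply: leeB; [apply: ereal_sup_ubound; exists z
                  |apply: ereal_inf_lbound; exists w].
have /andP[gamma0 gamma1] := gamma01.
have nR0 : 0 < n%:R :> R by rewrite ltr0n.
have [|m [mT gammam]] := ceil_log_contraction gamma (2 * L * Rad * n%:R) gamma01.
  by rewrite !mulr_gt0.
rewrite -[T]/(Num.max _ _) -mT.
have [th1 [S [Tth1 Sm near]]] :=
  iterate_suffix m th0 idx Rad0 bTheta T0 gTheta gamma0 contr Tth0.
pose H th z := f th z - pop_risk mu f th.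
have mH th : Theta th -> measurable_fun setT (H th).
  by move=> Tth; apply: measurable_funB => //; exact: mf.
have H_lip a b z : Theta a -> Theta b ->
    `|H a z - H b z| <= 2 * L * enorm (a - b).
  move=> Ta Tb; rewrite -mulrA.
  apply: (normr_centeredB_le mu (B := B) (a := h0 a) (b := h0 b)) => //;
    by [exact: mf|exact: osc|move=> w; exact: f_lip].
have H_le th z : Theta th -> `|H th z| <= B.
  by move=> Tth; apply: normr_centered_le; [exact: mf|exact: osc].
(* Start and index list are parameters, so that one set of bounds serves both the true iterate
   ([th0], [idx]) and the truncated one ([th1], [S]). *)
pose Phi a s (i : 'I_n) (zs : n.-tuple Z) := H (iterate g zs a s) (tnth zs i).
have bPhi a s i zs : Theta a -> `|Phi a s i zs| <= B.
  by move=> Ta; apply/H_le/(iterate_mem Theta).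
have mPhi a s i : Theta a -> measurable_fun setT (Phi a s i).
  move=> Ta; apply: (measurable_caratheodory (A := Theta) (h := H) (K := 2 * L)) => //.
  - by rewrite mulr_gt0.
  - by move=> zs; exact: iterate_mem.
  - by move=> k; exact: (measurable_iterate Theta g gTheta _ _ _ gamma0 mg contr).
  - exact: measurable_tnth.
have mean0 i : i \notin S -> iid_mean mu n (Phi th1 S i) = 0.
  move=> iS; apply: (iid_mean_eq0 mu i (mPhi _ _ _ Tth1)).
    by move=> zs; exact: bPhi.
  move=> zs; have Tit := iterate_mem Theta g gTheta zs th1 S Tth1.
  rewrite -[RHS](Rintegral_centered mu (mf _ Tit) (osc _ Tit)).
  apply: eq_Rintegral => z _.
  by rewrite /Phi iterate_tuple_upd// tnth_mktuple eqxx.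
have meanS i : i \notin S -> `|iid_mean mu n (Phi th0 idx i)| <= n%:R^-1.
  move=> iS.
  have mD : measurable_fun setT (fun zs => Phi th0 idx i zs - Phi th1 S i zs).
    by apply: measurable_funB; exact: mPhi.
  have bD zs : `|Phi th0 idx i zs - Phi th1 S i zs| <= n%:R^-1.
    apply: (le_trans (H_lip _ _ _ _ _)); [exact: (iterate_mem Theta)..|].
    have L2 : 0 < 2 * L by rewrite mulr_gt0.
    have := near zs; rewrite -(ler_pM2l L2) => /le_trans; apply.
    rewrite -[leRHS]mul1r ler_pdivlMr//; apply: le_trans gammam.
    by rewrite le_eqVlt; apply/orP; left; apply/eqP; ring.
  have -> : Phi th0 idx i =
      (fun zs => (Phi th0 idx i zs - Phi th1 S i zs) + Phi th1 S i zs).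
    by apply/funext => zs; rewrite subrK.
  rewrite (iid_meanD mu mD bD (mPhi _ _ _ Tth1) (fun zs => bPhi _ _ _ _ Tth1)).
  by rewrite mean0// addr0; exact: normr_iid_mean_le.
have mP i := mPhi th0 idx i Tth0.
have bP i zs := bPhi th0 idx i zs Tth0.
have mSum : measurable_fun setT (fun zs => \sum_(i < n) Phi th0 idx i zs).
  exact: measurable_sum.
have bSum zs : `|\sum_(i < n) Phi th0 idx i zs| <= \sum_(i < n) B.
  by apply: le_trans (ler_norm_sum _ _ _) (ler_sum _ _).
rewrite [X in iid_expect mu X](_ : _ =
  fun zs => n%:R^-1 * \sum_(i < n) Phi th0 idx i zs); last first.
  (* The population risk at the iterate is the same for all [i], so averaging its [n] copies returns
     it. *)
  apply/funext => zs; rewrite /emp_risk /Phi /H sumrB mulrBr sumr_const card_ord.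
  by rewrite -(mulr_natl (pop_risk mu f _)) mulKf// lt0r_neq0.
rewrite (iid_expectE mu (C := n%:R^-1 * \sum_(i < n) B)).
- rewrite lee_fin (iid_meanZl mu _ mSum bSum) (iid_mean_sum mu _ mP bP).
  rewrite normrM ger0_norm ?invr_ge0// mulrC ler_pM2r ?invr_gt0//.
  apply: le_trans (ler_norm_sum _ _ _) _.
  (* Granting [1/n] to every index, also those in [S], makes these terms sum to exactly 1; the rest
     is [B] times the number of distinct indices in [S]. *)
  apply: (@le_trans _ _ (\sum_(i < n) ((if i \in S then B else 0) + n%:R^-1))).
    apply: ler_sum => i _; case: ifPn => [_|iS]; last by rewrite add0r meanS.
    by rewrite (le_trans (normr_iid_mean_le mu (mP i) (bP i)))// lerDl invr_ge0.
  rewrite big_split/= sumr_const card_ord -(mulr_natl n%:R^-1) mulfV ?lt0r_neq0//.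
  rewrite lerD2r -big_mkcond/= sumr_const -(mulr_natr B) ler_pM2l// ler_nat.
  exact: leq_trans (card_size S) Sm.
- by apply: measurable_funM.
- by move=> zs; rewrite normrM ger0_norm ?invr_ge0// ler_wpM2l ?invr_ge0.
Qed.
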